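(* If $G$ is a finite abelian group and $n$ is an odd positive integer, then $$\operatorname{aw}(G \times \mathbb{Z}_n, 3) = \operatorname{aw}(G,3) + \operatorname{aw}(\mathbb{Z}_n,3) - 2.$$
   Context: $\mathbb{Z}_n$ is the cyclic group $\{0,\dots,n-1\}$ under addition mod $n$. A $k$-term arithmetic progression ($k$-AP) in an abelian group $H$ is a sequence $a, a+d, \dots, a+(k-1)d$ with $a,d \in H$ (degenerate ones allowed). An $r$-coloring of $H$ is a function $c: H \to \{1,\dots,r\}$; it is exact if surjective. A $k$-AP is rainbow under $c$ if $c(a+id) \neq c(a+jd)$ for all $0 \le i < j \le k-1$. $\operatorname{aw}(H,k)$ is the smallest $r$ such that every exact $r$-coloring of $H$ contains a rainbow $k$-AP; if $H$ has no $k$-AP, $\operatorname{aw}(H,k)=|H|+1$. *)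

(* Defs.v *)
From HB Require Import structures.
From mathcomp Require Import all_boot all_algebra.

Set Implicit Arguments.
Unset Strict Implicit.
Unset Printing Implicit Defensive.

Import GRing.Theory.
Local Open Scope ring_scope.

(* The library declares the finType and zmodType structures of a product, but
   not their join; this adds no operation. *)
HB.instance Definition _ (G K : finZmodType) := GRing.Zmodule.on (G * K)%type.

(* The cyclic group of order n, for n > 0: zmodp equips 'I_m.+1 with addition
   mod m.+1.  The library's 'Z_n is not used because 'Z_1 has two elements. *)
Notation cyclicZ n := ('I_n.-1.+1) (only parsing).

Section AntiVanDerWaerden.

Variables (H : finZmodType) (k : nat).

(* The colors 1, ..., r are represented by the elements 0, ..., r - 1 of 'I_r. *)
Definition exact_coloring (r : nat) (c : {ffun H -> 'I_r}) : bool :=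
  [forall y, exists x, c x == y].

Definition rainbow_AP (r : nat) (c : {ffun H -> 'I_r}) (a d : H) : bool :=
  [forall i : 'I_k, forall j : 'I_k,
     (i < j)%N ==> (c (a + d *+ i) != c (a + d *+ j))].

(* The condition 0 < r is needed: H is nonempty, so it has no 0-coloring and
   r = 0 would satisfy the second conjunct vacuously. *)
Definition aw_pred (r : nat) : bool :=
  (0 < r)%N &&
  [forall c : {ffun H -> 'I_r},
     exact_coloring c ==> [exists a, exists d, rainbow_AP c a d]].

Lemma aw_pred_card : aw_pred #|H|.+1.
Proof.
apply/andP; split=> //; apply/forallP=> c; apply/implyP=> /forallP ex_c.
have /(uniq_leq_size (enum_uniq _)) : {subset enum 'I_(#|H|.+1) <= codom c}.
  by move=> y _; have /existsP[x /eqP <-] := ex_c y; apply: codom_f.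
by rewrite size_codom -cardE card_ord ltnn.
Qed.

Lemma ex_aw : exists r, aw_pred r.
Proof. by exists #|H|.+1; exact: aw_pred_card. Qed.

(* The usual convention that aw(H, k) = |H| + 1 if H has no k-AP needs no
   separate clause: degenerate APs are allowed, so H always has a k-AP.  If no
   exact coloring of H has a rainbow k-AP, the minimum is |H| + 1, since there
   is no exact (|H| + 1)-coloring of H. *)
Definition aw : nat := ex_minn ex_aw.

End AntiVanDerWaerden.

(* Main.v *)
Require Import Defs.
From mathcomp Require Import all_boot all_algebra.
From mathcomp Require Import cyclic zify.

(** Let M(H) = aw(H, 3) - 1 be the largest number of colors of a coloring of H
    without rainbow 3-AP; the claim is M(G x Z_n) = M(G) + M(Z_n) - 1.

    Along any line x, x + d, x + 2d, ... two consecutive occurrences of a color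
    enclose a gap whose two ends have the same color.  Hence, if two colors meet
    at step d, one of them meets no third color at step d.

    For an exact sequence K -> H -> Q with Q of odd order, let q0 be a coset
    carrying the largest palette.  Every other coset has at most one color
    outside the palette of q0; recording that color gives a coloring of Q
    without rainbow 3-AP, so M(H) <= M(K) + M(Q) - 1.  Equality holds if an
    extremal coloring of Q gives 0 a color of its own: then the coset over 0 can
    be recolored by an extremal coloring of K.

    On Z_p, p an odd prime, such a coloring comes from any extremal one: for
    each d <> 0 some color takes part in all color changes at step d, and this
    color depends only on d up to sign and powers of 2.  Gluing along the prime
    factors of n gives it on Z_n. *)

Set Implicit Arguments.
Unset Strict Implicit.
Unset Printing Implicit Defensive.

Import GRing.Theory.

(** * Rainbow-free sequences *)

Section Sequences.
Variable T : eqType.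
Implicit Types (w : nat -> T) (y z : T).

Definition rainbow_free_seq w := forall i j k, i + k = j + j ->
  [\/ w i = w j, w j = w k | w i = w k].

Lemma rainbow_free_seq_shift w a :
  rainbow_free_seq w -> rainbow_free_seq (fun t => w (a + t)).
Proof. by move=> rf i j k e; apply: rf; lia. Qed.

(* If the ends differ, reflecting 0 and n forces the color w 0 at n + 1 (n odd) or
   n + 2 (n even); the progressions ending there then make w constant on the gap. *)
Lemma gap_ends w n : rainbow_free_seq w -> 1 < n -> w 0 = w n ->
  (forall t, 0 < t < n -> w t <> w 0) -> w 1 = w n.-1.
Proof.
move=> rf n_gt1 w0n inside.
have same i j k : i + k = j + j -> w i = w 0 -> 0 < j < n -> 0 < k < n ->
    w j = w k.
  move=> e wi /inside nj /inside nk.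
  by have [] := rf i j k e; rewrite ?wi => // e'; rewrite e' in nj nk.
have dbl t : 0 < t -> t + t < n -> w (t + t) = w t.
  by move=> t0 tn; apply/esym/(same 0) => //; lia.
have dblV t : 0 < t -> t + t < n -> w (n - (t + t)) = w (n - t).
  by move=> t0 tn; apply/esym/(same n); rewrite ?w0n //; lia.
apply/eqP/contraT => /eqP ne.
(* The progression [0, h, n + k] leaves [n + k] only the colors [w 0] and [w 1], the progression
   [n - k, n, n + k] only [w 0] and [w n.-1]. *)
have pinned k h : 0 < h < n -> 0 < k < n -> n + k = h + h -> w h = w 1 ->
    w (n - k) = w n.-1 -> w (n + k) = w 0.
  move=> hn kn e wh wk.
  have nh := inside h hn; have nk : w (n - k) <> w 0 by apply: inside; lia.
  have e1 : 0 + (n + k) = h + h by lia.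
  have e2 : (n - k) + (n + k) = n + n by lia.
  have [a1|a1|a1] := rf _ _ _ e1; first by case: nh.
  - have [a2|a2|a2] := rf _ _ _ e2.
    + by case: nk; rewrite a2.
    + by rewrite -a2.
    + by case: ne; rewrite -wh -wk a1 a2.
  - by [].
case: (boolP (odd n)) => n_odd.
- pose h := n./2; have nE : n = h + h + 1 by rewrite /h; lia.
  have wn1 : w (n + 1) = w 0.
    apply: (pinned 1 h.+1); rewrite ?subn1 //; try lia.
    have := dblV h; rewrite nE.
    have -> : h + h + 1 - (h + h) = 1 by lia.
    have -> : h + h + 1 - h = h.+1 by lia.
    by move=> -> //; lia.
  have odd_step v : 0 < v -> v + v + 2 < n -> w (n - (v + v + 1)) = w (n - v).
    by move=> v0 vn; apply/esym/(same (n + 1)) => //; lia.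
  (* Halving the distance to [n], by [dblV] if it is even and by [odd_step] if it is odd, ends at
     distance 1. *)
  have all_eq t : 0 < t < n -> w (n - t) = w n.-1.
    elim/ltn_ind: t => t IH tn.
    have [t1|t1] := leqP t 1; first by have -> : n - t = n.-1 by lia.
    rewrite -(IH t./2); try lia.
    case: (boolP (odd t)) => t_odd.
      by rewrite -(odd_step t./2); try lia; congr w; lia.
    by rewrite -(dblV t./2); try lia; congr w; lia.
  by case: ne; rewrite -(all_eq n.-1); try lia; congr w; lia.
- pose h := n./2; have nE : n = h + h by rewrite /h; lia.
  have [h1|h1] := leqP h 1; first by case: ne; congr w; lia.
  have w2 : w 2 = w 1 by rewrite -(dbl 1) //; lia.
  have wn2 : w (n + 2) = w 0.
    apply: (pinned 2 h.+1); try lia.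
      rewrite -w2; have := dblV h.-1.
      have -> : n - (h.-1 + h.-1) = 2 by lia.
      have -> : n - h.-1 = h.+1 by lia.
      by move=> -> //; lia.
    by have := dblV 1; rewrite subn1 => <- //; lia.
  have step v : 0 < v -> v.+1 < h -> w (n - v.+1) = w (n - v).
    move=> v0 vh; rewrite -(dblV v.+1); try lia.
    by apply/esym/(same (n + 2)) => //; lia.
  have all_eq v : 0 < v < h -> w (n - v) = w n.-1.
    elim: v => // v IH vh; have [v0|v0] := posnP v.
      by rewrite v0 subn1.
    by rewrite step; [apply: IH; lia | lia | lia].
  (* Doubling the distance [h.-1] leads to position 2, which has the color of 1. *)
  case: ne; rewrite -(all_eq h.-1); try lia.
  by rewrite -(dblV h.-1); try lia; rewrite -w2; congr w; lia.
Qed.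

Definition contact w y z t :=
  (w t = y /\ w t.+1 = z) \/ (w t = z /\ w t.+1 = y).

(** If [s] is the last occurrence of [y] up to [t], then [s] and [t.+1] bound a gap without [y], to
    which [gap_ends] applies. *)
Lemma previous_exit w y a t : rainbow_free_seq w ->
  w a = y -> a <= t -> w t <> y -> w t.+1 = y ->
  exists2 s, a <= s < t & w s = y /\ w s.+1 = w t.
Proof.
move=> rf wa le_at wt wt1.
have ex_s : exists s, (s <= t) && (w s == y) by exists a; rewrite le_at wa eqxx.
have ub s : (s <= t) && (w s == y) -> s <= t by case/andP.
case: (ex_maxnP ex_s ub) => s /andP[le_st /eqP ws] s_max.
have lt_st : s < t.
  by rewrite ltn_neqAle le_st andbT; apply/eqP => est; apply: wt; rewrite -est.
exists s; first by rewrite lt_st s_max // le_at wa eqxx.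
split=> //.
have /= := @gap_ends _ (t.+1 - s) (rainbow_free_seq_shift s rf).
have -> : s + (t.+1 - s) = t.+1 by lia.
have -> : s + (t.+1 - s).-1 = t by lia.
rewrite addn0 addn1 ws wt1; apply=> //; first by lia.
move=> i i_in wi; have := s_max (s + i); rewrite wi eqxx andbT.
by move=> /(_ ltac:(lia)); lia.
Qed.

(** Descent: a contact from [s] on enters a color that has occurred before, so [previous_exit]
    yields the reversed contact at an earlier time. *)
Lemma no_later_contact w y z a b s : rainbow_free_seq w -> y != z ->
  w a = y -> w b = z -> a <= s -> b <= s ->
  (forall t, t < s -> ~ contact w y z t) -> forall t, ~ contact w y z t.
Proof.
move=> rf /eqP ne wa wb as_ bs early; elim/ltn_ind=> t IH ct.
have [|st] := ltnP t s; first by move/early; apply.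
case: (ct) => -[wt wt1].
- have nwt : w t <> z by rewrite wt.
  have [u ut [wu wu1]] := previous_exit rf wb (leq_trans bs st) nwt wt1.
  by apply: (IH u); [lia | right; rewrite wu wu1 wt].
- have nwt : w t <> y by rewrite wt => /esym.
  have [u ut [wu wu1]] := previous_exit rf wa (leq_trans as_ st) nwt wt1.
  by apply: (IH u); [lia | left; rewrite wu wu1 wt].
Qed.

End Sequences.

Lemma rainbow_free_seq_comp (T U : eqType) (f : T -> U) w :
  rainbow_free_seq w -> rainbow_free_seq (f \o w).
Proof.
move=> rf i j k e.
by have [e'|e'|e'] := rf _ _ _ e;
  [constructor 1|constructor 2|constructor 3]; rewrite /= e'.
Qed.

Section Dichotomy.
Variable T : eqType.
Implicit Types (w : nat -> T).

Definition exits w (x : T) t :=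
  (w t = x /\ w t.+1 \notin [:: w 0; w 1]) \/
  (w t.+1 = x /\ w t \notin [:: w 0; w 1]).

(** Merge all colors other than [w 0] and [w 1] into one. Its first occurrence is preceded by only
    one of these two; the other has had no contact with it by then, hence never has. *)
Lemma not_both_exit w j k : rainbow_free_seq w -> w 0 != w 1 ->
  exits w (w 0) j -> exits w (w 1) k -> False.
Proof.
rewrite /exits => rf; set x := w 0; set y := w 1 => ne ex_j ex_k.
pose f a := if a == x then 0 else if a == y then 1 else 2.
have f2 a : (f a == 2) = (a \notin [:: x; y]).
  by rewrite /f !inE; case: (a == x); case: (a == y).
have f01 a : f a != 2 -> f a = 0 \/ f a = 1.
  by rewrite /f; case: (a == x); case: (a == y); auto.
have fx : f x = 0 by rewrite /f eqxx.
have fy : f y = 1 by rewrite /f eq_sym (negPf ne) eqxx.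
have rff := rainbow_free_seq_comp f rf.
have cj : contact (f \o w) 0 2 j.
  by case: ex_j => -[e]; rewrite -f2 => /eqP e2; [left|right]; rewrite /= e e2.
have ck : contact (f \o w) 1 2 k.
  by case: ex_k => -[e]; rewrite -f2 => /eqP e2; [left|right]; rewrite /= e e2.
have ex2 : exists s, f (w s) == 2.
  by case: cj => -[/= e1 e2]; [exists j.+1|exists j]; rewrite ?e1 ?e2.
case: (ex_minnP ex2) => s /eqP ws s_min.
have s_gt1 : 1 < s.
  by case: s ws {s_min} => [|[|//]]; rewrite -/x -/y ?fx ?fy.
have before t : t < s -> f (w t) != 2.
  by move=> ts; apply/negP => /s_min; lia.
have first_contact i : i < 2 -> f (w s.-1) != i -> forall t, t < s ->
    ~ contact (f \o w) i 2 t.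
  move=> i2 ne_i t ts [] [/= e1 e2]; last by have := before t ts; rewrite e1.
  have [ts1|ts1] := ltnP t.+1 s; first by have := before _ ts1; rewrite e2.
  by case/eqP: ne_i; rewrite -e1; congr (f (w _)); lia.
have [e|e] : f (w s.-1) = 0 \/ f (w s.-1) = 1 by apply/f01/before; lia.
- apply: (@no_later_contact _ _ 1 2 1 s s rff _ _ _ _ _ _ k ck) => //=; first by lia.
  by apply: first_contact; rewrite ?e.
- apply: (@no_later_contact _ _ 0 2 0 s s rff _ _ _ _ _ _ j cj) => //=.
  by apply: first_contact; rewrite ?e.
Qed.
End Dichotomy.

(** * Colorings and aw *)

Section Colorings.
Local Open Scope ring_scope.
Variable H : finZmodType.

(** In any abelian group the solutions of [x + z = y + y] are the 3-APs with difference [y - x]. An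
    arbitrary color type spares renumbering sums and options. *)
Definition rainbow_free (T : Type) (c : H -> T) := forall x y z,
  x + z = y + y -> [\/ c x = c y, c y = c z | c x = c z].

Lemma rainbow_free_comp (T U : Type) (f : T -> U) (c : H -> T) :
  rainbow_free c -> rainbow_free (f \o c).
Proof.
move=> rf x y z e.
by have [e'|e'|e'] := rf _ _ _ e;
  [constructor 1|constructor 2|constructor 3]; rewrite /= e'.
Qed.

Lemma rainbow_freeP r (c : {ffun H -> 'I_r}) :
  reflect (rainbow_free c) (~~ [exists a, exists d, rainbow_AP 3 c a d]).
Proof.
apply: (iffP idP) => [/existsPn rf x y z e | rf].
- have := rf x => /existsPn /(_ (y - x)) /forallPn[i /forallPn[j]].
  have pos k : (k < 3)%N -> x + (y - x) *+ k = nth 0 [:: x; y; z] k.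
    case: k => [|[|[|]]]//= _; rewrite ?mulr0n ?addr0 // ?mulr1n; last first.
      by rewrite mulr2n addrA (addrC x) subrK addrA -e [x + z]addrC addrK.
    by rewrite addrC subrK.
  rewrite negb_imply negbK !pos // => /andP[ij /eqP].
  case: i ij => -[|[|[|]]] //= _; case: j => -[|[|[|]]] //= _ _ ->.
  + by constructor 1.
  + by constructor 3.
  + by constructor 2.
- apply/existsPn => a; apply/existsPn => d; apply/negP => /forallP rb.
  have ne (i j : 'I_3) : (i < j)%N -> c (a + d *+ i) <> c (a + d *+ j).
    by move=> ij; apply/eqP; have /forallP/(_ j)/implyP/(_ ij) := rb i.
  have := rf (a + d *+ 0) (a + d *+ 1) (a + d *+ 2).
  case=> [|e|e|e].
  + by rewrite mulr0n mulr1n mulr2n addr0 !addrA (addrAC a d a).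
  + by case: (@ne (inord 0) (inord 1)); rewrite !inordK.
  + by case: (@ne (inord 1) (inord 2)); rewrite !inordK.
  + by case: (@ne (inord 0) (inord 2)); rewrite !inordK.
Qed.

Lemma rainbow_free_lt_aw (T : finType) (c : H -> T) :
  rainbow_free c -> (#|c @: [set: H]| < aw H 3)%N.
Proof.
move=> rf; rewrite ltnNge; apply/negP; rewrite /aw; case: ex_minnP => r.
case: r => // r /andP[_ /forallP all_c] _ r_le.
set S := c @: _ in r_le; pose s := enum S.
(* Colors are numbered by their index in [s], and all from index [r] on are merged into [r]; every
   value up to [r] is still taken. *)
pose f (y : T) : 'I_r.+1 := inord (minn (index y s) r).
have := all_c [ffun x => f (c x)].
case: (boolP (exact_coloring _)) => [_ /=|/negP[]].
  apply/negP/rainbow_freeP => x y z e; rewrite !ffunE.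
  exact: (rainbow_free_comp f rf e).
apply/forallP => y; have y_lt : (y < size s)%N.
  by rewrite -cardE (leq_trans (ltn_ord y)).
have : nth (c 0) s y \in S by rewrite -mem_enum mem_nth.
case/imsetP => x _ cx; apply/existsP; exists x; apply/eqP/val_inj.
rewrite ffunE /f -cx index_uniq ?enum_uniq //= inordK.
  by apply/minn_idPl; rewrite -ltnS.
by rewrite ltnS geq_minr.
Qed.

Lemma aw_gt1 : (1 < aw H 3)%N.
Proof.
have rf0 : rainbow_free (fun _ : H => tt) by move=> *; constructor 1.
apply: leq_ltn_trans (rainbow_free_lt_aw rf0).
by rewrite card_gt0; apply/set0Pn; exists tt; apply/imsetP; exists 0.
Qed.

Lemma aw_extremal : exists2 c : H -> 'I_(aw H 3).-1,
  rainbow_free c & #|c @: [set: H]| = (aw H 3).-1.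
Proof.
have := aw_gt1; rewrite /aw; case: ex_minnP => r _ r_min r_gt1.
have : ~~ aw_pred H 3 r.-1 by apply/negP => /r_min; lia.
rewrite negb_and -leqNgt leqNgt ltn_predRL r_gt1 /= => /forallPn[c].
rewrite negb_imply => /andP[/forallP ex_c /rainbow_freeP rf].
exists c => //; rewrite -[RHS]card_ord -cardsT; congr #|pred_of_set _|.
apply/setP => y; rewrite !inE; have /existsP[x /eqP <-] := ex_c y.
exact: imset_f.
Qed.

End Colorings.

(** Bisection of the stretch from [j] to [j + 2 ^ k]: if [w 0] and [w 1] differ, a midpoint of color
    [w 1] would give a rainbow progression. Otherwise one half again leads from color [w 0] to an
    outside color. *)
Lemma exit_of_power (T : eqType) (w : nat -> T) k j : rainbow_free_seq w ->
  w j = w 0 -> w (j + 2 ^ k) \notin [:: w 0; w 1] ->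
  exists2 t, w t = w 0 & w t.+1 \notin [:: w 0; w 1].
Proof.
move=> rf; elim: k j => [|k IH] j wj out; first by rewrite addn1 in out; exists j.
have [out'|] := boolP (w (j + 2 ^ k) \notin [:: w 0; w 1]); first exact: IH out'.
have e : j + (j + 2 ^ k.+1) = j + 2 ^ k + (j + 2 ^ k) by rewrite expnS; lia.
have e' : j + 2 ^ k.+1 = j + 2 ^ k + 2 ^ k by rewrite expnS; lia.
rewrite negbK !inE => /orP[]/eqP wm; first by apply: IH wm _; rewrite -e'.
have [w01|/eqP w01] := eqVneq (w 0) (w 1).
  by apply: IH (etrans wm (esym w01)) _; rewrite -e'.
move: out; rewrite !inE negb_or => /andP[/eqP out0 /eqP out1].
by have [] := rf _ _ _ e; rewrite ?wj ?wm // => /esym.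
Qed.

(** * Lines in a finite abelian group *)

Section Lines.
Local Open Scope ring_scope.
Variables (H : finZmodType) (T : eqType) (c : H -> T).
Hypothesis rf : rainbow_free c.
Implicit Types x y d : H.

Lemma rainbow_free_line x d : rainbow_free_seq (fun j => c (x + d *+ j)).
Proof. by move=> i j k e; apply: rf; rewrite addrACA -mulrnDr e mulrnDr addrACA. Qed.

Lemma rainbow_free_reflect x y : c x != c y -> c (y + y - x) \in [:: c x; c y].
Proof.
move=> /eqP ne; rewrite !inE; have [||->|->] := @rf x y (y + y - x).
- by rewrite addrC subrK.
- by [].
- by rewrite eqxx orbT.
- by rewrite eqxx.
Qed.

Lemma mulrn_finZmod_card (x : H) : x *+ #|H| = 0.
Proof.
apply: (@addrI _ (\sum_(y : H) y)); rewrite addr0 -sumr_const -big_split /=.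
by rewrite [RHS](reindex_inj (addIr x)).
Qed.

(** As [#|H|] annihilates the group, a backward step is [#|H|.-1] forward ones; this puts both
    directions on one sequence indexed by naturals. *)
Lemma line_reverse (x d : H) t : x - d *+ t = x + d *+ (#|H|.-1 * t).
Proof.
congr (_ + _); apply/eqP; rewrite eq_sym -subr_eq0 opprK -mulrnDr.
have -> : (#|H|.-1 * t + t = #|H| * t)%N.
  by rewrite -mulSnr prednK //; apply/card_gt0P; exists 0.
by rewrite mulrnA mulrn_finZmod_card mul0rn.
Qed.

(** If both points had outside colors, [exit_of_power] along the line and along its reversal would
    let both [c x] and [c (x + d)] meet a third color, against [not_both_exit]. *)
Lemma half_way_color x d k : c x != c (x + d) ->
  (c (x + d *+ 2 ^ k) \in [:: c x; c (x + d)]) ||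
  (c (x + d - d *+ 2 ^ k) \in [:: c x; c (x + d)]).
Proof.
move=> ne; apply/contraT; rewrite negb_or => /andP[out1 out2].
have swap (a b : T) : [:: a; b] =i [:: b; a] by move=> e; rewrite !inE orbC.
have [] := @exit_of_power _ _ k 0%N (rainbow_free_line x d).
- by [].
- by rewrite add0n mulr0n addr0 mulr1n.
move=> j /=; rewrite !(mulr0n, addr0, mulr1n) => cj cj1.
have [] := @exit_of_power _ _ k 0%N (rainbow_free_line (x + d) (- d)).
- by [].
- by rewrite add0n mulr0n addr0 mulr1n addrK mulNrn swap.
move=> l /=; rewrite !(mulr0n, addr0, mulr1n) addrK => cl cl1.
exfalso; apply: (@not_both_exit _ _ j (#|H|.-1 * l)%N (rainbow_free_line x d));
  rewrite /= /exits !(mulr0n, addr0, mulr1n) //.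
- by left.
- have e1 : x + d *+ (#|H|.-1 * l) = x + d + (- d) *+ l.+1.
    by rewrite -line_reverse mulrS mulNrn addrA addrK.
  have e2 : x + d *+ (#|H|.-1 * l).+1 = x + d + (- d) *+ l.
    by rewrite mulrS addrCA -line_reverse mulNrn addrCA addrA.
  by right; rewrite e1 e2 cl; split=> //; rewrite swap.
Qed.

End Lines.

(** Euler's theorem: 2 to the power [totient #|Q|] is 1 modulo [#|Q|]. *)
Lemma odd_doubling_period (Q : finZmodType) : odd #|Q| ->
  exists2 j, 0 < j & forall q : Q, (q *+ 2 ^ j = q)%R.
Proof.
move=> odd_Q; exists (totient #|Q|); first by rewrite totient_gt0 odd_gt0.
move=> q; have /Euler_exp_totient : coprime 2 #|Q| by rewrite coprime2n.
move=> e; rewrite (divn_eq (2 ^ totient #|Q|) #|Q|) e mulrnDr mulnC mulrnA.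
rewrite mulrn_finZmod_card mul0rn add0r.
(* In the trivial group [1 %% #|Q|] is 0, not 1. *)
have [Q1|Q1] := leqP #|Q| 1; last by rewrite modn_small.
have -> : q = 0%R by apply: (card_le1_eqP Q1).
by rewrite mul0rn.
Qed.

(** * Palettes of cosets *)

Section ExactSequence.
Local Open Scope ring_scope.
Variables (K H Q : finZmodType) (i : K -> H) (pi : H -> Q).
Hypotheses (iD : {morph i : x y / x + y}) (piD : {morph pi : x y / x + y}).
Hypothesis pi_surj : forall q, exists h, pi h = q.
Hypothesis pi_ker : forall h, pi h = 0 <-> exists k, i k = h.
Hypothesis odd_Q : odd #|Q|.
Implicit Types (h x y : H) (q a b d : Q).

Lemma exact_proj0 : pi 0 = 0.
Proof. by apply: (@addrI _ (pi 0)); rewrite -piD !addr0. Qed.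

Lemma exact_projN x : pi (- x) = - pi x.
Proof. by apply: (@addrI _ (pi x)); rewrite -piD !subrr exact_proj0. Qed.

Lemma exact_projMn x n : pi (x *+ n) = pi x *+ n.
Proof. by elim: n => [|n IH]; rewrite ?exact_proj0 // !mulrS piD IH. Qed.

Section Palettes.
Variables (T : finType) (c : H -> T).
Hypothesis rf : rainbow_free c.

Definition palette q := c @: [set h | pi h == q].

Lemma mem_palette h : c h \in palette (pi h).
Proof. by apply: imset_f; rewrite inE. Qed.

Lemma paletteP q t : reflect (exists2 h, pi h = q & c h = t) (t \in palette q).
Proof.
apply: (iffP imsetP) => [[h]|[h]].
- by rewrite inE => /eqP e ->; exists h.
- by move=> <- <-; exists h; rewrite // inE.
Qed.

Lemma card_palette q : (#|palette q| < aw K 3)%N.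
Proof.
have [h <-] := pi_surj q.
have rfK : rainbow_free (fun k => c (h + i k)).
  by move=> x y z e; apply: rf; rewrite addrACA -iD e iD addrACA.
apply: leq_ltn_trans (rainbow_free_lt_aw rfK).
apply/subset_leq_card/subsetP => t /paletteP[x ex <-].
have /pi_ker[k ek] : pi (x - h) = 0 by rewrite piD exact_projN ex subrr.
by apply/imsetP; exists k; rewrite // ek addrC subrK.
Qed.

Lemma palette_diff a b : (1 < #|palette a :\: palette b|)%N ->
  (#|palette b :\: palette a| <= 1)%N.
Proof.
case/card_gt1P=> t [u []]; rewrite !inE => /andP[tb /paletteP[x xa cx]].
case/andP=> ub /paletteP[y ya cy] tu.
(* R is stable under doubling, a permutation of Q; so is its complement, which
   contains b - a. *)
pose R d := (t \in palette (a + d)) || (u \in palette (a + d)).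
have R_refl v w d : pi v = a -> pi w = a + d -> c v != c w ->
    c v \in [:: t; u] -> c w \in [:: t; u] -> R (d + d).
  move=> va wd ne vt wt; have := rainbow_free_reflect rf ne.
  have e : pi (w + w - v) = a + (d + d).
    by rewrite !piD exact_projN va wd addrACA addrAC addrK.
  rewrite /R -e; have := mem_palette (w + w - v).
  by move: vt wt; rewrite !inE => /orP[]/eqP-> /orP[]/eqP-> m /orP[]/eqP<-;
    rewrite m ?orbT.
have R_double d : R d -> R (d + d).
  case/orP=> /paletteP[w wd cw].
  - by apply: (R_refl y w) => //; rewrite ?cw ?cy 1?eq_sym // !inE eqxx ?orbT.
  - by apply: (R_refl x w) => //; rewrite ?cw ?cx // !inE eqxx ?orbT.
have R_pow d k : R d -> R (d *+ 2 ^ k).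
  move=> Rd; elim: k => [|k IH]; first by rewrite mulr1n.
  by rewrite expnS mulnC mulrnA mulr2n; apply: R_double.
have ab : a + (b - a) = b by rewrite addrC subrK.
have nRb : ~~ R (b - a) by rewrite /R ab negb_or tb.
have nR2 : ~~ R ((b - a) + (b - a)).
  apply: contra nRb => R2; have [[//|j] _ per] := odd_doubling_period odd_Q.
  by rewrite -(per (b - a)) expnS mulrnA; apply: R_pow.
(* Suppose [r] and [s] are missing over [a]. The reflection of [x] in [w] has color [s], since [t]
   is missing over its coset; reflecting that point in [v] leads back to the coset [a] with color
   [r] or [s]. *)
rewrite leqNgt; apply/negP => /card_gt1P[r [s []]].
rewrite !inE => /andP[ra /paletteP[v vb cv]] /andP[sa /paletteP[w wb cw]] rs.
have : c (w + w - x) \in [:: t; s].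
  rewrite -cx -cw; apply: rainbow_free_reflect => //; rewrite cx cw.
  by apply: contraNneq tb => ->; apply/paletteP; exists w.
have wx : pi (w + w - x) = a + ((b - a) + (b - a)).
  by rewrite !piD exact_projN xa wb addrA ab addrA.
move: nR2; rewrite negb_or -wx => /andP[nt _].
rewrite !inE => /orP[]/eqP cwx; first by rewrite -cwx mem_palette in nt.
have back : pi (v + v - (w + w - x)) = a.
  by rewrite !piD exact_projN !piD exact_projN vb wb xa opprB addrC subrK.
have : c (v + v - (w + w - x)) \in [:: s; r].
  by rewrite -cwx -cv; apply: rainbow_free_reflect; rewrite // cwx cv eq_sym.
have := mem_palette (v + v - (w + w - x)); rewrite back.
by rewrite !inE => m /orP[]/eqP e; rewrite -e m in ra sa.
Qed.

Lemma max_palette : exists q0, forall q, (#|palette q :\: palette q0| <= 1)%N.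
Proof.
have [q0 _ q0_max] := @arg_maxnP Q 0 predT (fun q => #|palette q|) isT.
exists q0 => q; rewrite leqNgt; apply/negP => lt1.
have le1 := palette_diff lt1; have := q0_max q isT.
have := cardsID (palette q0) (palette q); have := cardsID (palette q) (palette q0).
by rewrite [palette q0 :&: _]setIC /=; lia.
Qed.

(* H may have even order, so x and y need not have a midpoint in H: only the
   coset halfway between theirs is reached, along multiples 2^j of y - x. *)
Lemma midpoint_color x y d : pi y = pi x + (d + d) -> c x != c y ->
  exists2 h, pi h = pi x + d & c h \in [:: c x; c y].
Proof.
move=> ey ne; have [[//|j] _ per] := odd_doubling_period odd_Q.
have exy : x + (y - x) = y by rewrite addrC subrK.
have pid : pi ((y - x) *+ 2 ^ j) = d.
  rewrite exact_projMn piD exact_projN ey addrAC subrr add0r -mulr2n -mulrnA.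
  by rewrite -expnS per.
have := @half_way_color _ _ _ rf x (y - x) j; rewrite exy.
case/(_ ne)/orP => m; [exists (x + (y - x) *+ 2 ^ j)|exists (y - (y - x) *+ 2 ^ j)] => //.
  by rewrite piD pid.
by rewrite piD exact_projN pid ey -addrA addrK.
Qed.

Lemma rainbow_free_card_exact :
  (#|c @: [set: H]| + 2 < aw K 3 + aw Q 3)%N.
Proof.
have [q0 q0_max] := max_palette.
(* [None] marks the palettes contained in that of [q0]; for the others the pick has a single
   candidate by [q0_max]. *)
pose c' q := [pick t in palette q :\: palette q0].
have c'1 q t : c' q = Some t -> t \in palette q /\ t \notin palette q0.
  by rewrite /c'; case: pickP => // s; rewrite inE => /andP[? ?] [<-].
have c'2 q t : t \in palette q -> t \notin palette q0 -> c' q = Some t.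
  move=> tq tq0; have tD : t \in palette q :\: palette q0 by rewrite inE tq0.
  rewrite /c'; case: pickP => [s sD|/(_ t)]; last by rewrite tD.
  by congr Some; apply: (card_le1_eqP (q0_max q)).
have rf' : rainbow_free c'.
  move=> a b e abe.
  have refl a' b' e' t u : a' + e' = b' + b' -> c' a' = Some t -> c' b' = Some u ->
      t != u -> c' e' = Some t \/ c' e' = Some u.
    move=> abe' /c'1[/paletteP[x xa cx] nt] /c'1[/paletteP[y yb cy] nu] tu.
    have := rainbow_free_reflect rf (x := x) (y := y); rewrite cx cy => /(_ tu).
    have ez : pi (y + y - x) = e'.
      by rewrite !piD exact_projN xa yb -abe' addrAC subrr add0r.
    have := mem_palette (y + y - x); rewrite ez !inE => m /orP[]/eqP em.
      by left; rewrite em in m; apply: c'2.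
    by right; rewrite em in m; apply: c'2.
  case ea: (c' a) => [t|]; case eb: (c' b) => [u|]; case ee: (c' e) => [v|];
    try by [constructor 1|constructor 2|constructor 3].
  - have [->|tu] := eqVneq t u; first by constructor 1.
    by have [<-|<-] := refl _ _ _ _ _ abe ea eb tu; rewrite ee;
      [constructor 3|constructor 2].
  - have [->|tu] := eqVneq t u; first by constructor 1.
    by have [] := refl _ _ _ _ _ abe ea eb tu; rewrite ee.
  (* Here only the middle coset has no outside color, and [midpoint_color] gives it one. *)
  - have [->|tv] := eqVneq t v; first by constructor 3.
    case/c'1: ea => /paletteP[x xa cx] nt; case/c'1: ee => /paletteP[y ye cy] nv.
    have eyx : pi y = pi x + ((b - a) + (b - a)).
      by rewrite xa ye addrA [a + _]addrC subrK addrA -abe addrAC subrr add0r.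
    have := midpoint_color eyx; rewrite cx cy => /(_ tv)[h].
    rewrite xa [a + _]addrC subrK => hb; have := mem_palette h; rewrite hb.
    by rewrite !inE => m /orP[]/eqP em; rewrite em in m; rewrite (c'2 b _ m) in eb.
  - have [->|vu] := eqVneq u v; first by constructor 2.
    have [] := refl e b a v u _ ee eb; rewrite ?ea //; first by rewrite addrC.
    by rewrite eq_sym.
have := rainbow_free_lt_aw rf'; have := card_palette q0.
(* Besides [None], taken at [q0], the coloring [c'] takes every color outside the palette of [q0];
   the palette itself has fewer than [aw K 3] colors. *)
have sub : None |: (Some @: (c @: [set: H] :\: palette q0)) \subset c' @: [set: Q].
  apply/subsetP => o; rewrite !inE => /orP[/eqP->|/imsetP[t]].
    apply/imsetP; exists q0 => //; case e: (c' q0) => [t|//].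
    by have [tq ntq] := c'1 _ _ e; rewrite tq in ntq.
  rewrite inE => /andP[nt /imsetP[h _ eh]] ->; apply/imsetP; exists (pi h) => //.
  by apply/esym/c'2; rewrite // eh mem_palette.
move: (subset_leq_card sub); rewrite cardsU1 card_imset; last by move=> ? ? [].
have -> : None \notin Some @: (c @: [set: H] :\: palette q0).
  by apply/imsetP => -[].
have := cardsID (palette q0) (c @: [set: H]).
have := subset_leq_card (subsetIr (c @: [set: H]) (palette q0)).
by move=> /=; lia.
Qed.

End Palettes.

Lemma aw_exact_le : (aw H 3 + 2 <= aw K 3 + aw Q 3)%N.
Proof.
have [c rf ec] := aw_extremal H; have := rainbow_free_card_exact rf.
by rewrite ec; have := aw_gt1 H; lia.
Qed.
End ExactSequence.

Definition unitary (H : finZmodType) (T : Type) (c : H -> T) :=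
  forall x, c x = c 0%R -> x = 0%R.

Lemma color_outside (H : finZmodType) (T : finType) (c : H -> T) (s : seq T) :
  size s < #|c @: [set: H]| -> exists x, c x \notin s.
Proof.
move=> lt_s; apply/existsP; apply: contraLR lt_s => /existsPn sub.
rewrite -leqNgt (leq_trans _ (card_size s)) //.
apply/subset_leq_card/subsetP => _ /imsetP[x _ ->].
by have := sub x; rewrite negbK.
Qed.

(** * Unitary colorings *)

Section Gluing.
Local Open Scope ring_scope.
Variables (K H Q : finZmodType) (i : K -> H) (pi : H -> Q).
Hypotheses (iD : {morph i : x y / x + y}) (piD : {morph pi : x y / x + y}).
Hypothesis i_inj : injective i.
Hypothesis pi_surj : forall q, exists h, pi h = q.
Hypothesis pi_ker : forall h, pi h = 0 <-> exists k, i k = h.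
Hypothesis odd_Q : odd #|Q|.

Lemma odd_double_eq0 (q : Q) : q + q = 0 -> q = 0.
Proof.
move=> e; have [[//|j] _ per] := odd_doubling_period odd_Q.
by rewrite -(per q) expnS mulrnA mulr2n e mul0rn.
Qed.

(** A progression projects to one in [Q] that is constant or, [Q] being odd, has distinct terms. In
    the latter case two terms agree under [u]; neither is [0], as [u] is unitary, so [C] agrees
    there too. Only the color [u 0] is lost. *)
Lemma glue_colorings (T U : finType) (c : K -> T) (u : Q -> U) :
  rainbow_free c -> rainbow_free u -> unitary u ->
  exists C : H -> T + U, [/\ rainbow_free C,
    (#|c @: [set: K]| + #|u @: [set: Q]| <= #|C @: [set: H]| + 1)%N
    & unitary c -> unitary C].
Proof.
(* The default [0] does not matter, since [C] uses [lift] only on the image of [i]. *)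
move=> rfc rfu uu; pose lift h := odflt 0 [pick k | i k == h].
have liftK k : lift (i k) = k.
  rewrite /lift; case: pickP => [l /eqP/i_inj //|/(_ k)]; by rewrite eqxx.
have i0 : i 0 = 0 by apply: (@addrI _ (i 0)); rewrite -iD !addr0.
have pii k : pi (i k) = 0 by apply/pi_ker; exists k.
pose C h : T + U := if pi h == 0 then inl (c (lift h)) else inr (u (pi h)).
have Ci k : C (i k) = inl (c k) by rewrite /C pii eqxx liftK.
have Cn h : pi h != 0 -> C h = inr (u (pi h)) by rewrite /C => /negPf->.
exists C; split.
- move=> x y z e.
  have epi : pi x + pi z = pi y + pi y by rewrite -!piD e.
  have same h h' : u (pi h) = u (pi h') -> pi h <> pi h' -> C h = C h'.
    move=> uh nh; have [p0|p0] := eqVneq (pi h) 0.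
      by case: nh; rewrite p0; apply/esym/uu; rewrite -uh p0.
    have [p0'|p0'] := eqVneq (pi h') 0.
      by case: nh; rewrite p0'; apply/uu; rewrite uh p0'.
    by rewrite !Cn // uh.
  have [pxy|/eqP pxy] := eqVneq (pi x) (pi y).
    have pzy : pi z = pi y by apply: (@addrI _ (pi x)); rewrite epi pxy.
    have [p0|p0] := eqVneq (pi y) 0; last by constructor 1; rewrite !Cn ?pxy.
    have [[kx ex] [ky ey] [kz ez]] :
        [/\ exists k, i k = x, exists k, i k = y & exists k, i k = z].
      by split; apply/pi_ker; rewrite ?pxy ?pzy.
    have ek : kx + kz = ky + ky by apply: i_inj; rewrite !iD ex ey ez.
    rewrite -ex -ey -ez !Ci.
    by have [->|->|->] := rfc _ _ _ ek;
      [constructor 1|constructor 2|constructor 3].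
  have pyz : pi y <> pi z.
    by move=> eyz; apply: pxy; apply: (@addIr _ (pi z)); rewrite epi eyz.
  have pxz : pi x <> pi z.
    move=> exz; apply: pxy; apply/eqP; rewrite -subr_eq0; apply/eqP.
    by apply: odd_double_eq0; rewrite addrACA {2}exz epi -opprD subrr.
  by have [e'|e'|e'] := rfu _ _ _ epi;
    [constructor 1|constructor 2|constructor 3]; apply: same.
- have sub : (inl @: (c @: [set: K])) :|: (inr @: (u @: [set: Q] :\ u 0))
      \subset C @: [set: H].
    apply/subsetP => s; rewrite inE => /orP[] /imsetP[t].
      by move=> /imsetP[k _ ->] ->; rewrite -Ci imset_f.
    rewrite !inE => /andP[nt /imsetP[q _ eq]] ->; have [h hq] := pi_surj q.
    apply/imsetP; exists h => //; rewrite Cn hq ?eq //.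
    by apply: contraNneq nt => q0; rewrite eq q0.
  move: (subset_leq_card sub); rewrite cardsU.
  have -> : inl @: (c @: [set: K]) :&: inr @: (u @: [set: Q] :\ u 0) = set0
      :> {set T + U}.
    apply/setP => s; rewrite !inE; apply/negP => /andP[/imsetP[? _ ->]].
    by case/imsetP.
  have inlI : injective (@inl T U) by move=> ? ? [].
  have inrI : injective (@inr T U) by move=> ? ? [].
  rewrite cards0 (card_imset _ inlI) (card_imset _ inrI).
  by rewrite (cardsD1 (u 0) (u @: _)) imset_f //=; lia.
- move=> uc h; rewrite -{1}i0 Ci; have [p0|p0] := eqVneq (pi h) 0.
    by case/pi_ker: p0 => k <-; rewrite Ci => -[/uc ->].
  by rewrite Cn.
Qed.

End Gluing.

(** * Groups of odd prime order *)

Section PrimeOrder.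
Local Open Scope ring_scope.
Variable Q : finZmodType.
Hypothesis odd_Q : odd #|Q|.
Hypothesis Q_gen : forall d x : Q, d != 0 -> exists j, x = d *+ j.
Implicit Types (d x y z : Q).

Lemma shift_closed_full (P : pred Q) d x : d != 0 ->
  (forall y, P y -> P (y + d)) -> P x -> forall y, P y.
Proof.
move=> d0 Pd Px y; have [j e] := Q_gen (y - x) d0.
have -> : y = x + d *+ j by rewrite -e addrC subrK.
by elim: j {e} => [|j IH]; rewrite ?addr0 // mulrSr addrA Pd.
Qed.

Section Center.
Variables (T : finType) (c : Q -> T).
Hypothesis rf : rainbow_free c.
Hypothesis c_gt2 : (2 < #|c @: [set: Q]|)%N.

(** Behind [center] and [leaf] is the graph joining the colors that meet at step [d]: a center lies
    on every edge, and a leaf [t] has no neighbor other than [s]. *)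
Definition center d t :=
  [forall y, (c y != c (y + d)) ==> (t \in [:: c y; c (y + d)])].

Definition leaf d t s :=
  [forall y, ((c y == t) ==> (c (y + d) \in [:: t; s])) &&
             ((c (y + d) == t) ==> (c y \in [:: t; s]))].

Lemma leaf_end d y : d != 0 -> c y != c (y + d) ->
  leaf d (c y) (c (y + d)) || leaf d (c (y + d)) (c y).
Proof.
move=> d0 ne; apply/contraT; rewrite negb_or.
have swap (a b : T) : [:: a; b] =i [:: b; a] by move=> e; rewrite !inE orbC.
have exitP t s : ~~ leaf d t s -> exists j,
    (c (y + d *+ j) = t /\ c (y + d *+ j.+1) \notin [:: t; s]) \/
    (c (y + d *+ j.+1) = t /\ c (y + d *+ j) \notin [:: t; s]).
  case/forallPn=> z; have [j ez] := Q_gen (z - y) d0.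
  have -> : z = y + d *+ j by rewrite -ez addrC subrK.
  rewrite -addrA -mulrSr negb_and !negb_imply => out; exists j.
  by case/orP: out => /andP[/eqP ? ?]; [left|right].
case/andP=> /exitP[j ej] /exitP[k ek].
exfalso; apply: (@not_both_exit _ _ j k (rainbow_free_line rf y d));
  rewrite /= /exits /= !(mulr0n, addr0, mulr1n) //.
by case: ek => -[e1 e2]; [left|right]; rewrite swap.
Qed.

(** The graph of color changes is connected, because [d] generates [Q], and each edge has a leaf end
    by [leaf_end]; such a graph is a star. *)
Lemma ex_center d : d != 0 -> exists t, center d t.
Proof.
move=> d0.
have [x ne] : exists x, c x != c (x + d).
  apply/existsP/contraT => /existsPn same.
  have [y] := color_outside (s := [:: c 0]) (ltnW c_gt2).
  rewrite inE => /negP[]; move: y.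
  apply: (shift_closed_full (P := fun y => c y == c 0) d0 _ (eqxx _)) => y.
  by have := same y; rewrite negbK => /eqP <-.
(* [s] is the candidate center and [t] an adjacent leaf; if [s] is a leaf too, its only neighbor is
   [t]. *)
have [t [s [ts [z cz] lts tP]]] : exists t s, [/\ t != s,
    exists z, c z = s, leaf d t s & forall r, leaf d s r -> t \in [:: s; r]].
  case/orP: (leaf_end d0 ne) => lf.
  - exists (c x), (c (x + d)); split=> //; first by exists (x + d).
    by move=> r /forallP/(_ x)/andP[_]; rewrite eqxx.
  - exists (c (x + d)), (c x); split=> //; first by rewrite eq_sym.
      by exists x.
    by move=> r /forallP/(_ x)/andP[]; rewrite eqxx.
(* The colors that are s or meet only s are closed under steps of d. *)
have star : forall y, (c y == s) || leaf d (c y) s.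
  apply: (shift_closed_full (x := z) d0); last by rewrite cz eqxx.
  move=> y; have [<-|ney] := eqVneq (c y) (c (y + d)); first by [].
  case/orP=> [/eqP cy|/forallP/(_ y)/andP[]]; last first.
    by rewrite eqxx !inE /= => /orP[/eqP e|->] //; rewrite e eqxx in ney.
  case/orP: (leaf_end d0 ney); rewrite cy; last by move=> ->; rewrite orbT.
  move/tP; rewrite !inE (negPf ts) /= => /eqP <-.
  by rewrite lts orbT.
exists s; apply/forallP => y; apply/implyP => ney; rewrite !inE eq_sym.
case/orP: (star y) => [-> //|/forallP/(_ y)/andP[+ _]].
rewrite eqxx !inE /= => /orP[/eqP e|/eqP ->]; last by rewrite eqxx orbT.
by rewrite e eqxx in ney.
Qed.

(** With two centers all changes would be between them, so a third color would never change and
    would fill [Q]. *)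
Lemma center_inj d t s : d != 0 -> center d t -> center d s -> t = s.
Proof.
move=> d0 /forallP ct /forallP cs; apply/eqP/contraT => ts.
have [x] := color_outside (s := [:: t; s]) c_gt2.
have [y] := color_outside (s := [:: c x; c x]) c_gt2.
rewrite !inE orbb !negb_or => /negP nyx /andP[xt xs]; case: nyx; move: y.
apply: (shift_closed_full (P := fun y => c y == c x) d0 _ (eqxx _)) => y /eqP cy.
apply/contraT => ney; have := implyP (ct y); have := implyP (cs y).
rewrite cy eq_sym ney !inE => /(_ isT) + /(_ isT).
rewrite ![_ == c x]eq_sym (negPf xt) (negPf xs) /= => /eqP es /eqP et.
by rewrite es et eqxx in ts.
Qed.

(** [None] is reserved for [0], to make the coloring unitary. *)
Definition center_color d : option T :=
  if d == 0 then None else [pick t | center d t].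

Lemma center_colorE d t : d != 0 -> center d t -> center_color d = Some t.
Proof.
move=> d0 ct; rewrite /center_color (negPf d0).
case: pickP => [s cs|/(_ t)]; last by rewrite ct.
by rewrite (center_inj d0 ct cs).
Qed.

Lemma center_colorP d : d != 0 -> exists2 t, center_color d = Some t & center d t.
Proof.
by move=> d0; have [t ct] := ex_center d0; exists t => //; apply: center_colorE.
Qed.

Lemma center_color_unitary : unitary center_color.
Proof.
move=> d; rewrite {2}/center_color eqxx; have [//|d0] := eqVneq d 0.
by have [t ->] := center_colorP d0.
Qed.

(** If [y] and [y + d + d] differ in color, [y + d] agrees with one of them, so the same change of
    colors occurs at step [d]. *)
Lemma center_color_double d : center_color (d + d) = center_color d.
Proof.
have [->|d0] := eqVneq d 0; first by rewrite addr0.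
have dd0 : d + d != 0 by apply: contraNneq d0 => /(odd_double_eq0 odd_Q) ->.
have [t -> /forallP ct] := center_colorP d0.
apply: center_colorE => //; apply/forallP => y; apply/implyP => ne.
rewrite addrA in ne *.
have /rf[e|e|e] : y + (y + d + d) = (y + d) + (y + d).
  by rewrite [RHS]addrACA -!addrA.
- by have := implyP (ct (y + d)); rewrite -e; apply.
- by have := implyP (ct y); rewrite e; apply.
- by rewrite e eqxx in ne.
Qed.

Lemma center_colorN d : center_color (- d) = center_color d.
Proof.
have [->|d0] := eqVneq d 0; first by rewrite oppr0.
have [t -> /forallP ct] := center_colorP d0.
apply: center_colorE; rewrite ?oppr_eq0 //; apply/forallP => y; apply/implyP => ne.
have := implyP (ct (y - d)); rewrite subrK eq_sym => /(_ ne).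
by rewrite !inE orbC.
Qed.

Lemma center_color_step x y : c x != c y ->
  center_color (y - x) \in [:: Some (c x); Some (c y)].
Proof.
move=> ne; have d0 : y - x != 0 by rewrite subr_eq0; apply: contraNneq ne => ->.
have [t -> /forallP/(_ x)/implyP] := center_colorP d0.
rewrite [x + _]addrC subrK => /(_ ne); rewrite !inE.
by case/orP=> /eqP ->; rewrite eqxx ?orbT.
Qed.

(** Two colors that are never centers would contradict [center_color_step]; at most one color is
    lost, and [None] makes up for it. *)
Lemma card_center_color :
  (#|c @: [set: Q]| <= #|center_color @: [set: Q]|)%N.
Proof.
pose D := [set t | Some t \in center_color @: [set: Q]].
have le1 : (#|c @: [set: Q] :\: D| <= 1)%N.
  apply/card_le1_eqP => _ _ /setDP[/imsetP[x _ ->] nx] /setDP[/imsetP[y _ ->] ny].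
  apply/eqP/contraT => /center_color_step; rewrite !inE in nx ny *.
  have := imset_f center_color (in_setT (x - y)).
  by move=> m /orP[]/eqP e; rewrite e ?(negPf nx) ?(negPf ny) in m.
have sub : None |: (Some @: (c @: [set: Q] :&: D)) \subset center_color @: [set: Q].
  apply/subsetP => o; rewrite !inE => /orP[/eqP->|/imsetP[t]].
    by apply/imsetP; exists 0; rewrite // /center_color eqxx.
  by rewrite !inE => /andP[_ m] ->.
move: (subset_leq_card sub); rewrite cardsU1 card_imset; last by move=> ? ? [].
have -> : None \notin Some @: (c @: [set: Q] :&: D) by apply/imsetP => -[].
by move: le1 (cardsID D (c @: [set: Q])) => /=; lia.
Qed.

(** Progressions through [0] are [0, y, 2y], its reversal, or [x, 0, -x]; invariance under doubling
    and negation settles them. *)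
Lemma scaling_invariant_rainbow_free (U : eqType) (u : Q -> U) :
  (forall d, u (d + d) = u d) -> (forall d, u (- d) = u d) ->
  (forall x y z, x + z = y + y -> x != 0 -> y != 0 -> z != 0 ->
    [\/ u x = u y, u y = u z | u x = u z]) -> rainbow_free u.
Proof.
move=> u2 uN u_nz x y z e.
have [x0|x0] := eqVneq x 0.
  by constructor 2; rewrite -[RHS](congr1 u (add0r z)) -x0 e u2.
have [z0|z0] := eqVneq z 0.
  by constructor 1; rewrite -(congr1 u (addr0 x)) -z0 e u2.
have [y0|y0] := eqVneq y 0; last exact: u_nz.
by constructor 3; rewrite -uN; congr u; apply/eqP;
  rewrite eq_sym -addr_eq0 addrC e y0 addr0.
Qed.

(* With centers t, s, r at steps x, 2y, z and x + z = 2y, a fourth color could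
   change neither at step x nor at step 2y, and so would fill Q. *)
Lemma center_color_rainbow_free : (3 < #|c @: [set: Q]|)%N ->
  rainbow_free center_color.
Proof.
move=> c_gt3; apply: scaling_invariant_rainbow_free center_color_double center_colorN _.
move=> x y z e x0 y0 z0.
have [t ext /forallP ct] := center_colorP x0.
have [s eys _] := center_colorP y0.
have [r ezr /forallP cr] := center_colorP z0.
have yy0 : y + y != 0 by apply: contraNneq y0 => /(odd_double_eq0 odd_Q) ->.
have [s' eys' /forallP cs] := center_colorP yy0.
have es : s' = s by move: eys'; rewrite center_color_double eys => -[].
rewrite {s' eys'}es in cs; rewrite ext eys ezr.
have [->|ts] := eqVneq t s; first by constructor 1.
have [->|sr] := eqVneq s r; first by constructor 2.
have [->|tr] := eqVneq t r; first by constructor 3.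
have [v] := color_outside (s := [:: t; s; r]) c_gt3.
have [w] := color_outside (s := [:: c v; c v]) c_gt2.
rewrite !inE orbb !negb_or => /negP nwv /and3P[vt vs vr]; case: nwv; move: w.
apply: (shift_closed_full (P := fun w => c w == c v) x0 _ (eqxx _)) => w /eqP cw.
apply/contraT => ne; have := implyP (ct w); rewrite cw eq_sym ne => /(_ isT).
rewrite !inE [t == _]eq_sym (negPf vt) /= => /eqP et.
have := implyP (cr (w + x)); rewrite -addrA e; have := implyP (cs w); rewrite cw.
rewrite !inE -et [s == c v]eq_sym (negPf vs) [r == t]eq_sym (negPf tr) /=.
have [<-|_] := eqVneq (c v) (c (w + (y + y))).
  by rewrite [r == c v]eq_sym (negPf vr) [t == c v]eq_sym vt => _ /(_ isT).
by move=> /(_ isT)/eqP <-; rewrite ts [r == s]eq_sym (negPf sr) => /(_ isT).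
Qed.

End Center.

(** For at most two colors, [0] against the rest suffices; from four on, [center_color] serves;
    three colors call for a coarser version of it. *)
Lemma unitary_coloring (T : finType) (c : Q -> T) : rainbow_free c ->
  (1 < #|Q|)%N -> exists (U : finType) (u : Q -> U),
  [/\ rainbow_free u, unitary u & (#|c @: [set: Q]| <= #|u @: [set: Q]|)%N].
Proof.
move=> rf Q_gt1; have [c_le2|c_gt2] := leqP #|c @: [set: Q]| 2.
  exists bool, (fun d => d == 0); split.
  - move=> x y z _; case: (x == 0); case: (y == 0); case: (z == 0);
      by [constructor 1|constructor 2|constructor 3].
  - by move=> x; rewrite eqxx => /eqP.
  - apply: leq_trans c_le2 _; rewrite -card_bool -cardsT.
    apply/subset_leq_card/subsetP => b _; apply/imsetP.
    case: b; first by exists 0; rewrite ?eqxx.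
    have : (1 < #|[set: Q]|)%N by rewrite cardsT.
    rewrite (cardsD1 0) inE ltnS => /card_gt0P[d]; rewrite !inE andbT => d0.
    by exists d; rewrite // (negPf d0).
have [c_le3|c_gt3] := leqP #|c @: [set: Q]| 3; last first.
  exists (option T), (center_color c); split.
  - exact: center_color_rainbow_free.
  - exact: center_color_unitary.
  - exact: card_center_color.
(* With three colors, merging the values of center_color into two nonempty
   classes, besides {0}, leaves no rainbow progression avoiding 0. *)
have F_gt2 := leq_trans c_gt2 (card_center_color rf c_gt2).
have [d0] := color_outside (s := [:: None]) (ltnW F_gt2).
have [d1] := color_outside (s := [:: None; center_color c d0]) F_gt2.
set F := center_color c; rewrite !inE negb_or => /andP[d1N d1d0] d0N.
exists (option bool), (fun d => omap (fun _ => F d == F d0) (F d)); split.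
- apply: scaling_invariant_rainbow_free => /= [d|d|x y z _ x0 y0 z0].
  + by rewrite /F center_color_double.
  + by rewrite /F center_colorN.
  have F_some d : d != 0 -> exists t, F d = Some t.
    by move=> /(center_colorP rf c_gt2)[t]; exists t.
  have [[? ->] [? ->] [? ->]] := And3 (F_some x x0) (F_some y y0) (F_some z z0).
  case: (_ == F d0); case: (_ == F d0); case: (_ == F d0);
    by [constructor 1|constructor 2|constructor 3].
- move=> x /= e; apply: (center_color_unitary rf c_gt2).
  have F0 : F 0 = None by rewrite /F /center_color eqxx.
  by move: e; rewrite -/F F0; case: (F x).
- apply: leq_trans c_le3 _.
  have <- : (#|{: option bool}| = 3)%N by rewrite card_option card_bool.
  rewrite -cardsT; apply/subset_leq_card/subsetP => o _; apply/imsetP.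
  case: o => [[]|].
  + by exists d0; rewrite // eqxx; case: (F d0) d0N.
  + by exists d1; rewrite // (negPf d1d0); case: (F d1) d1N.
  + by exists 0; rewrite // /F /center_color eqxx.
Qed.

End PrimeOrder.

(** * Cyclic groups *)

Lemma cyclicZ_inZpE n k : 0 < n -> (inZp k : cyclicZ n) = k %% n :> nat.
Proof. by case: n. Qed.

Lemma cyclicZ_lt n (x : cyclicZ n) : 0 < n -> x < n.
Proof. by case: n x => // n x _; apply: ltn_ord. Qed.

Lemma cyclicZ_addE n (x y : cyclicZ n) : 0 < n -> (x + y)%R = (x + y) %% n :> nat.
Proof. by case: n x y. Qed.

Lemma cyclicZ_prime_gen p (d x : cyclicZ p) : prime p -> d != 0%R ->
  exists j, x = (d *+ j)%R.
Proof.
move=> p_pr d0; have p_gt0 := prime_gt0 p_pr.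
have d_gt0 : 0 < d by rewrite lt0n.
have : coprime d p.
  rewrite coprime_sym prime_coprime //; apply/negP => /(dvdn_leq d_gt0).
  by rewrite leqNgt cyclicZ_lt.
case/(coprimeP _ d_gt0) => -[u v] /= e.
(* [u] is an inverse of [d] modulo [p]. *)
exists (u * x); rewrite Zp_mulrn; apply: ord_inj; rewrite cyclicZ_inZpE //.
have -> : d * (u * x) = v * x * p + x by nia.
by rewrite modnMDl modn_small // cyclicZ_lt.
Qed.

Section CyclicExtension.
Variables m p : nat.
Hypotheses (m_gt0 : 0 < m) (p_gt0 : 0 < p).

(** Together with [cyclicZ_mod] this is the exact sequence from Z_m through Z_mp to Z_p. It need not
    split: repeated prime factors are covered. *)
Definition cyclicZ_mul (k : cyclicZ m) : cyclicZ (m * p) := inZp (k * p).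
Definition cyclicZ_mod (h : cyclicZ (m * p)) : cyclicZ p := inZp h.

Let mp_gt0 : 0 < m * p. Proof. by rewrite muln_gt0 m_gt0. Qed.

Lemma cyclicZ_mulD : {morph cyclicZ_mul : x y / (x + y)%R}.
Proof.
move=> x y; apply: ord_inj; rewrite cyclicZ_addE // !cyclicZ_inZpE //.
rewrite cyclicZ_addE // muln_modl // modn_mod.
by rewrite mulnDl modnDm.
Qed.

Lemma cyclicZ_modD : {morph cyclicZ_mod : x y / (x + y)%R}.
Proof.
move=> x y; apply: ord_inj; rewrite cyclicZ_addE // !cyclicZ_inZpE //.
rewrite cyclicZ_addE // modn_dvdm ?dvdn_mull //.
by rewrite modnDm.
Qed.

Lemma cyclicZ_mul_inj : injective cyclicZ_mul.
Proof.
move=> x y /(congr1 (@nat_of_ord _)) /eqP; rewrite !cyclicZ_inZpE // -!muln_modl //.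
by rewrite eqn_pmul2r // !modn_small ?cyclicZ_lt // => /eqP; apply: ord_inj.
Qed.

Lemma cyclicZ_mod_surj q : exists h, cyclicZ_mod h = q.
Proof.
exists (inZp q); apply: ord_inj.
by rewrite !cyclicZ_inZpE // modn_dvdm ?dvdn_mull // modn_small ?cyclicZ_lt.
Qed.

Lemma cyclicZ_mod_ker h :
  cyclicZ_mod h = 0%R <-> exists k, cyclicZ_mul k = h.
Proof.
split=> [/(congr1 (@nat_of_ord _)) /eqP|[k <-]].
- rewrite [X in X == _]cyclicZ_inZpE // -/(dvdn p h) => p_h.
  exists (inZp (h %/ p)); apply: ord_inj; rewrite !cyclicZ_inZpE //.
  by rewrite muln_modl // modn_mod divnK // modn_small ?cyclicZ_lt.
- apply: ord_inj; rewrite !cyclicZ_inZpE // modn_dvdm ?dvdn_mull //.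
  by rewrite modnMl.
Qed.

End CyclicExtension.

(** Induction on [n], splitting off its least prime factor: gluing reaches the upper bound
    [aw_exact_le], so the unitary coloring it yields is extremal. *)
Lemma cyclicZ_unitary n : odd n ->
  exists (T : finType) (u : cyclicZ n -> T), [/\ rainbow_free u, unitary u
    & aw (cyclicZ n) 3 <= #|u @: [set: cyclicZ n]| + 1].
Proof.
elim/ltn_ind: n => n IH n_odd.
have [n_le1|n_gt1] := leqP n 1.
  have [c rf ec] := aw_extremal (cyclicZ n).
  exists _, c; split=> //; last by rewrite ec; lia.
  move=> x _; apply: val_inj; have /= := ltn_ord x; lia.
have p_pr := pdiv_prime n_gt1; have p_gt0 := prime_gt0 p_pr.
have nE : n = n %/ pdiv n * pdiv n by rewrite divnK ?pdiv_dvd.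
move: nE IH p_pr p_gt0; set m := n %/ pdiv n; set p := pdiv n => nE IH p_pr p_gt0.
have m_gt0 : 0 < m by move: n_gt1; rewrite nE; case: (m).
have /andP[m_odd p_odd] : odd m && odd p by rewrite -oddM -nE.
have p_gt1 := prime_gt1 p_pr.
have m_lt : m < n by rewrite nE ltn_Pmulr.
have [T [v [rfv uv v_le]]] := IH m m_lt m_odd.
have card_p : #|cyclicZ p| = p by rewrite card_ord prednK.
have odd_card : odd #|cyclicZ p| by rewrite card_p.
have [c rfc ec] := aw_extremal (cyclicZ p).
have gen (d x : cyclicZ p) := @cyclicZ_prime_gen p d x p_pr.
have [|U [w [rfw uw w_le]]] := unitary_coloring odd_card gen rfc.
  by rewrite card_p.
have {}w_le : aw (cyclicZ p) 3 <= #|w @: [set: cyclicZ p]| + 1.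
  by rewrite addn1 -ltnS; move: w_le; rewrite ec; case: (aw _ _).
have le := aw_exact_le (cyclicZ_mulD m_gt0 p_gt0) (cyclicZ_modD m_gt0 p_gt0)
  (cyclicZ_mod_surj m_gt0 p_gt0) (cyclicZ_mod_ker m_gt0 p_gt0) odd_card.
have [C [rfC C_le uC]] := glue_colorings (cyclicZ_mulD m_gt0 p_gt0)
  (cyclicZ_modD m_gt0 p_gt0) (@cyclicZ_mul_inj _ _ m_gt0 p_gt0)
  (cyclicZ_mod_surj m_gt0 p_gt0) (cyclicZ_mod_ker m_gt0 p_gt0) odd_card rfv rfw uw.
rewrite nE; exists (T + U)%type, C; split=> //; first exact: uC.
rewrite -(leq_add2r 2); apply: leq_trans le _; apply: leq_trans (leq_add v_le w_le) _.
by rewrite addnACA leq_add2r.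
Qed.

Theorem theorem8 (G : finZmodType) (n : nat) (n_odd : odd n) :
  aw (G * cyclicZ n)%type 3 = aw G 3 + aw (cyclicZ n) 3 - 2.
Proof.
pose i (g : G) : (G * cyclicZ n)%type := (g, 0%R).
pose pi (h : (G * cyclicZ n)%type) := h.2.
have iD : {morph i : x y / (x + y)%R} by move=> x y; congr pair; rewrite addr0.
have piD : {morph pi : x y / (x + y)%R} by [].
have i_inj : injective i by move=> x y [].
have pi_surj q : exists h, pi h = q by exists (0%R, q).
have pi_ker h : pi h = 0%R <-> exists k, i k = h.
  by case: h => g q; split=> [/= ->|[k [_ <-]]//]; exists g.
have odd_card : odd #|cyclicZ n| by rewrite card_ord prednK ?odd_gt0.
have le := aw_exact_le iD piD pi_surj pi_ker odd_card.
have [T [u [rfu uu u_le]]] := cyclicZ_unitary n_odd.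
have [c rfc ec] := aw_extremal G.
have [C [rfC C_le _]] := glue_colorings iD piD i_inj pi_surj pi_ker odd_card rfc rfu uu.
rewrite ec in C_le.
(* The upper bound comes from the exact sequence, the lower one from gluing an extremal coloring of
   [G] into a unitary extremal coloring of the cyclic group. *)
have squeeze a g z k v : a + 2 <= g + z -> k < a -> g.-1 + v <= k + 1 ->
  z <= v + 1 -> 1 < g -> a = g + z - 2 by lia.
exact: squeeze le (rainbow_free_lt_aw rfC) C_le u_le (aw_gt1 G).
Qed.
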